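(* Let $G$ be a finite group. The localization maps $A(-) \to A(-)[e_L^{-1}]$ assemble into a canonical isomorphism of $\mathcal{I}$-Tambara functors \[ A(-) \to \prod_{(L) \leq G \text{ perfect}} A(-)[e_L^{-1}], \] the product being over conjugacy classes of perfect subgroups, where $\mathcal{I}$ is the intersection $\mathcal{I} = \bigcap_{(L) \leq G} \mathcal{I}_L$ of the indexing systems $\mathcal{I}_L$ of admissible sets for $e_L$, taken over conjugacy classes of perfect subgroups $L\le G$.
   Context: For $H \leq G$, $A(H)$ is the Burnside ring of finite $H$-sets. $A(-)$ is a Tambara functor with restrictions $R^H_K$, transfers $T_K^H$ and norms $N_K^H$ given by restriction, induction and co-induction $X\mapsto\mathrm{Map}_K(H,X)$. For $Q\leq G$ the mark $\phi^Q\colon A(G)\to\mathbb{Z}$ is the ring homomorphism with $\phi^Q([S])=|S^Q|$. For a finite group $Q$, $O^{\mathrm{solv}}(Q)$ is the unique minimal normal subgroup with solvable quotient; $Q$ is perfect iff $Q=O^{\mathrm{solv}}(Q)$. By Dress, conjugacy classes of perfect subgroups $L\le G$ correspond bijectively to primitive idempotents $e_L\in A(G)$, where $\phi^Q(e_L)=1$ if $O^{\mathrm{solv}}(Q)$ is conjugate in $G$ to $L$, and $0$ otherwise. $A(-)[e_L^{-1}]$ is the levelwise localization, with value $A(H)[R^G_H(e_L)^{-1}]$ at $H\leq G$. Indexing system: a contravariant functor $\mathcal{J}$ from the orbit category of $G$ to symmetric monoidal categories and strong symmetric monoidal functors, $G/H\mapsto\mathcal{J}(H)$, which is a subfunctor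 of $G/H\mapsto \mathcal{S}et^H$ (finite $H$-sets under disjoint union, with restriction and conjugation functors), such that (1) $\mathcal{J}(H)$ is a full symmetric monoidal subcategory of $\mathcal{S}et^H$ containing all trivial $H$-sets; (2) each $\mathcal{J}(H)$ is closed under finite limits; (3) if $H/K\in\mathcal{J}(H)$ and $T\in\mathcal{J}(K)$ then $H\times_K T\in\mathcal{J}(H)$. Levelwise intersections of finitely many indexing systems are indexing systems. $\mathcal{I}_L$ is the indexing system for which a finite $H$-set lies in $\mathcal{I}_L(H)$ iff each of its orbits is isomorphic to some $H/K$ such that every $L'\leq H$ conjugate in $G$ to $L$ is contained in $K$. Incomplete Tambara functors: the category of bispans has as objects finite $G$-sets and as morphisms isomorphism classes of diagrams $X\leftarrow Y\to Z\to W$ of finite $G$-sets (encoding a restriction, then a norm, then a transfer), with the usual composition used to define Tambara functors. For an indexing system $\mathcal{J}$, the bispans whose middle map $f\colon Y\to Z$ satisfies $G_{f(y)}/G_y\in\mathcal{J}(G_{f(y)})$ for all $y\in Y$ (with $G_y$ the stabilizer) form a subcategory. A $\mathcal{J}$-Tambara functor is a product-preserving functor from this subcategory to sets whose values are abelian groups under the addition induced by transfers along fold maps; morphisms are natural transformations. $A(-)$ is an $\mathcal{I}$-Tambara functor by forgetting norms. Each $A(-)[e_L^{-1}]$ is an $\mathcal{I}_L$-Tambara functor with norms inherited from $A(-)$ (determined by compatibility with the localization map $A(-)\to A(-)[e_L^{-1}]$), and hence an $\mathcal{I}$-Tambara functor by forgetting structure. *)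

(* Defs.v *)
From HB Require Import structures.
From mathcomp Require Import all_boot all_order all_algebra.
From mathcomp Require Import all_fingroup all_solvable.

Set Implicit Arguments.
Unset Strict Implicit.
Unset Printing Implicit Defensive.

Import GroupScope GRing.Theory.

(** * Finite H-sets

   Group actions are right actions, as everywhere in MathComp.  A left
   H-set is the same thing as a right H-set via x . h := h^-1 x; under this
   dictionary stabilizers and fixed points do not change, and the left orbit
   H/K becomes the set of right cosets K :* h. *)

Section HSets.
Variable gT : finGroupType.
Implicit Types (H K L Q : {group gT}) (g : gT).

Record hset H := HSet { hcar :> finType; hact : action H hcar }.

Record hmap H (S T : hset H) := HMap {
  hfun :> S -> T;
  hfunP : forall x, {in H, forall a, hfun (hact S x a) = hact T (hfun x) a} }.

Definition hiso H (S T : hset H) := exists f : hmap S T, bijective f.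

Definition htrivial H (S : hset H) := forall x, {in H, forall a, hact S x a = x}.

Lemma hact1 H (S : hset H) x : hact S x 1 = x.
Proof. exact: act1. Qed.

Lemma hactM H (S : hset H) x :
  {in H &, forall a b, hact S x (a * b) = hact S (hact S x a) b}.
Proof. by move=> a b Ha Hb; rewrite actMin. Qed.

(** The library type [action H T] has elements of all of gT as arguments; those
   outside H are made to act trivially. *)
Section MkHSet.
Variables (H : {group gT}) (T : finType) (f : T -> gT -> T).
Hypothesis f1 : forall x, f x 1 = x.
Hypothesis fM : forall x, {in H &, forall a b, f x (a * b) = f (f x a) b}.

Lemma mk_is_action : is_action H (fun x a => if a \in H then f x a else x).
Proof.
split=> [a x y /=|x a b Ha Hb]; last by rewrite groupM // Ha Hb fM.
case: ifP => // Ha /(congr1 (f^~ a^-1)).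
by rewrite -!fM ?groupV // mulgV !f1.
Qed.

Definition mk_hset : hset H := HSet (Action mk_is_action).

Lemma mk_hsetE x a : a \in H -> hact mk_hset x a = f x a.
Proof. by rewrite /= => ->. Qed.
End MkHSet.

Section Sub.
Variables (H : {group gT}) (S : hset H) (P : pred S).
Hypothesis PH : forall x, {in H, forall a, P x -> P (hact S x a)}.

Let f (x : {x | P x}) a : {x | P x} := insubd x (hact S (val x) a).

Let fE x a : a \in H -> val (f x a) = hact S (val x) a.
Proof. by move=> Ha; rewrite insubdK //; apply: PH => //; apply: valP. Qed.

Lemma sub_hset1 x : f x 1 = x.
Proof. by apply: val_inj; rewrite fE // hact1. Qed.

Lemma sub_hsetM x : {in H &, forall a b, f x (a * b) = f (f x a) b}.
Proof. by move=> a b Ha Hb; apply: val_inj; rewrite !fE ?groupM // hactM. Qed.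

Definition sub_hset : hset H := mk_hset sub_hset1 sub_hsetM.

Lemma sub_hsetE (x : sub_hset) a :
  a \in H -> val (hact sub_hset x a) = hact S (val x) a.
Proof. by move=> Ha; rewrite mk_hsetE // fE. Qed.
End Sub.

Section Triv.
Variables (H : {group gT}) (T : finType).
Definition triv_hset : hset H :=
  @mk_hset H T (fun x _ => x) (fun _ => erefl) (fun _ _ _ _ _ => erefl).
End Triv.

Section Sum.
Variables (H : {group gT}) (S T : hset H).
Let f (x : S + T) a : S + T :=
  match x with inl s => inl (hact S s a) | inr t => inr (hact T t a) end.

Lemma sum_hset1 x : f x 1 = x. Proof. by case: x => x /=; rewrite hact1. Qed.
Lemma sum_hsetM x : {in H &, forall a b, f x (a * b) = f (f x a) b}.
Proof. by move=> a b Ha Hb; case: x => x /=; rewrite hactM. Qed.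
Definition sum_hset : hset H := mk_hset sum_hset1 sum_hsetM.

Lemma inl_hmapP x :
  {in H, forall a, (inl (hact S x a) : sum_hset) = hact sum_hset (inl x) a}.
Proof. by move=> a Ha; rewrite mk_hsetE. Qed.
Definition inl_hmap : hmap S sum_hset := HMap inl_hmapP.

Lemma inr_hmapP x :
  {in H, forall a, (inr (hact T x a) : sum_hset) = hact sum_hset (inr x) a}.
Proof. by move=> a Ha; rewrite mk_hsetE. Qed.
Definition inr_hmap : hmap T sum_hset := HMap inr_hmapP.
End Sum.

Section Fold.
Variables (H : {group gT}) (S : hset H).
Definition fold_fun (x : sum_hset S S) : S :=
  match x with inl s => s | inr s => s end.
Lemma fold_hmapP x :
  {in H, forall a, fold_fun (hact (sum_hset S S) x a) = hact S (fold_fun x) a}.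
Proof. by move=> a Ha; rewrite mk_hsetE //; case: x. Qed.
Definition fold_hmap : hmap (sum_hset S S) S := HMap fold_hmapP.

Definition id_hmap : hmap S S := @HMap H S S id (fun _ _ _ => erefl).
End Fold.

Section Pair.
Variables (H : {group gT}) (S T : hset H).
Let f (x : S * T) a : S * T := (hact S x.1 a, hact T x.2 a).
Lemma pair_hset1 x : f x 1 = x. Proof. by case: x => x y; rewrite /f !hact1. Qed.
Lemma pair_hsetM x : {in H &, forall a b, f x (a * b) = f (f x a) b}.
Proof. by move=> a b Ha Hb; rewrite /f !hactM. Qed.
Definition pair_hset : hset H := mk_hset pair_hset1 pair_hsetM.

Lemma pair_hsetE (x : pair_hset) a :
  a \in H -> hact pair_hset x a = (hact S x.1 a, hact T x.2 a).
Proof. by move=> Ha; rewrite mk_hsetE. Qed.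
End Pair.

Section Prod.
Variables (H : {group gT}) (I : finType) (D : I -> hset H).
Let f (x : {dffun forall i, D i}) a : {dffun forall i, D i} :=
  [ffun i => hact (D i) (x i) a].
Lemma prod_hset1 x : f x 1 = x.
Proof. by apply/ffunP=> i; rewrite ffunE hact1. Qed.
Lemma prod_hsetM x : {in H &, forall a b, f x (a * b) = f (f x a) b}.
Proof. by move=> a b Ha Hb; apply/ffunP=> i; rewrite !ffunE hactM. Qed.
Definition prod_hset : hset H := mk_hset prod_hset1 prod_hsetM.
End Prod.

(** The limit of a finite diagram, with objects [D i] (i in I) and arrows
   [F e : D (src e) -> D (tgt e)] (e in E), as the set of compatible families. *)
Section Lim.
Variables (H : {group gT}) (I E : finType) (src tgt : E -> I).
Variables (D : I -> hset H) (F : forall e, hmap (D (src e)) (D (tgt e))).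
Definition compatible (x : prod_hset D) :=
  [forall e, F e (x (src e)) == x (tgt e)].
Lemma compatibleP x :
  {in H, forall a, compatible x -> compatible (hact (prod_hset D) x a)}.
Proof.
move=> a Ha /forallP cx; apply/forallP=> e.
by rewrite mk_hsetE // !ffunE hfunP // (eqP (cx e)).
Qed.
Definition lim_hset : hset H := sub_hset compatibleP.
End Lim.

(** The orbit H/K. *)
Section Coset.
Variables (H K : {group gT}).

Definition rtrans_hset : hset H :=
  @mk_hset H {set gT} (fun A a => A :* a) (@rcoset1 gT)
    (fun A a b _ _ => rcosetM A a b).

Lemma rcosets_stable (A : rtrans_hset) :
  {in H, forall a, A \in rcosets K H -> hact rtrans_hset A a \in rcosets K H}.
Proof.
move=> a Ha /rcosetsP[h Hh ->]; rewrite mk_hsetE // -rcosetM.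
by apply/rcosetsP; exists (h * a); rewrite ?groupM.
Qed.
Definition coset_hset : hset H := sub_hset rcosets_stable.

Lemma coset_mem h : h \in H -> K :* h \in rcosets K H.
Proof. by move=> Hh; apply/rcosetsP; exists h. Qed.

Definition mk_coset h (Hh : h \in H) : coset_hset :=
  exist (fun A => A \in rcosets K H) (K :* h) (coset_mem Hh).

Lemma coset_hsetE (x : coset_hset) a : a \in H -> val (hact coset_hset x a) = val x :* a.
Proof. by move=> Ha; rewrite sub_hsetE // mk_hsetE. Qed.
End Coset.

(** Restriction along the homomorphism K -> H, k |-> g k g^-1.  For g = 1 this
   is the restriction from H to K, for K = H :^ g it is a conjugation. *)
Section Res.
Variables (H K : {group gT}) (g : gT) (sKH : K \subset H :^ g) (S : hset H).
Let f (x : S) k : S := hact S x (k ^ g^-1).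
Lemma res_hset1 x : f x 1 = x.
Proof. by rewrite /f conj1g hact1. Qed.
Lemma res_hsetM x : {in K &, forall a b, f x (a * b) = f (f x a) b}.
Proof.
move=> a b Ka Kb; rewrite /f conjMg hactM // -mem_conjg.
  exact: (subsetP sKH).
exact: (subsetP sKH).
Qed.
Definition res_hset : hset K := mk_hset res_hset1 res_hsetM.
End Res.

(** Induction H x_K S, that is, S x H modulo (s k, h) ~ (s, k h). *)
Section Ind.
Variables (H K : {group gT}) (S : hset K).

Definition ind_class (s : S) (h : gT) : {set S * gT} :=
  [set (hact S s k, k^-1 * h) | k in K].

Definition is_ind_class (O : {set S * gT}) :=
  [exists s : S, [exists h in H, O == ind_class s h]].

Lemma ind_classM s h : {in K, forall k, ind_class s (k * h) = ind_class (hact S s k) h}.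
Proof.
move=> k Kk; apply/setP=> y; apply/imsetP/imsetP=> -[b Kb ->].
  exists (k^-1 * b); first by rewrite groupM ?groupV.
  by rewrite -hactM ?groupM ?groupV // invMg invgK mulKVg !mulgA.
exists (k * b); first by rewrite groupM.
by rewrite hactM // invMg !mulgA mulgKV.
Qed.

Let f (O : {set S * gT}) (a : gT) : {set S * gT} :=
  [set (x.1, x.2 * a) | x in O].

Lemma ind_hset1 O : f O 1 = O.
Proof.
rewrite /f -[RHS]imset_id; apply: eq_imset => -[x y] /=; by rewrite mulg1.
Qed.

Lemma ind_hsetM O : {in H &, forall a b, f O (a * b) = f (f O a) b}.
Proof.
move=> a b _ _; rewrite /f -imset_comp; apply: eq_imset => -[x y] /=.
by rewrite mulgA.
Qed.

Let pre_hset : hset H := mk_hset ind_hset1 ind_hsetM.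

Lemma ind_stable (O : pre_hset) :
  {in H, forall a, is_ind_class O -> is_ind_class (hact pre_hset O a)}.
Proof.
move=> a Ha /existsP[s /existsP[h /andP[Hh /eqP->]]]; rewrite mk_hsetE //.
apply/existsP; exists s; apply/existsP; exists (h * a); rewrite groupM //=.
rewrite /f -imset_comp; apply/eqP; apply: eq_imset => k /=.
by rewrite mulgA.
Qed.
Definition ind_hset : hset H := sub_hset ind_stable.
End Ind.

(** Co-induction Map_K(H, S).  With right actions an element is a map
   F : H -> S such that F (h k) = F h . k, and (F . a) h = F (a h); in terms of
   the corresponding left actions, f h := F h^-1 satisfies f (k h) = k f h and
   (a f) h = f (h a). *)
Section Coind.
Variables (H K : {group gT}) (S : hset K).

Let f (F : {ffun subg_of H -> S}) (a : gT) : {ffun subg_of H -> S} :=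
  [ffun h => F (subg H a * h)].

Lemma coind_hset1 F : f F 1 = F.
Proof. by apply/ffunP=> h; rewrite ffunE morph1 mul1g. Qed.

Lemma coind_hsetM F : {in H &, forall a b, f F (a * b) = f (f F a) b}.
Proof. by move=> a b Ha Hb; apply/ffunP=> h; rewrite !ffunE subgM // mulgA. Qed.

Let pre_hset : hset H := mk_hset coind_hset1 coind_hsetM.

Definition coind_equivariant (F : {ffun subg_of H -> S}) :=
  [forall h : subg_of H, [forall k in K, F (h * subg H k) == hact S (F h) k]].

Lemma coind_stable (F : pre_hset) :
  {in H, forall a, coind_equivariant F -> coind_equivariant (hact pre_hset F a)}.
Proof.
move=> a Ha /forallP eF; rewrite mk_hsetE //; apply/forallP=> h.
by apply/forall_inP=> k Kk; rewrite !ffunE mulgA; apply: (forall_inP (eF _)).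
Qed.
Definition coind_hset : hset H := sub_hset coind_stable.
End Coind.

End HSets.

Arguments hset {gT} H.
Arguments triv_hset {gT} H T.
Arguments coset_hset {gT} H K.
Arguments ind_hset {gT} H [K] S.
Arguments coind_hset {gT} H [K] S.

(** * Indexing systems

   A full subcategory is given by its class of objects.  Closure under the
   restrictions along all K -> H, k |-> g k g^-1, is functoriality on the orbit
   category, as every map G/K -> G/H is induced by such a g. *)

Section Indexing.
Variable gT : finGroupType.
Implicit Types H K L : {group gT}.

Record indexing_system := IndexingSystem {
  adm : forall H, hset H -> Prop;
  adm_iso : forall H (S T : hset H), hiso S T -> adm S -> adm T;
  adm_res : forall H K g (sKH : K \subset H :^ g) (S : hset H),
    adm S -> adm (res_hset sKH S);
  adm_triv : forall H (S : hset H), htrivial S -> adm S;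
  adm_sum : forall H (S T : hset H), adm S -> adm T -> adm (sum_hset S T);
  adm_lim : forall H (I E : finType) (src tgt : E -> I) (D : I -> hset H)
      (F : forall e, hmap (D (src e)) (D (tgt e))),
    (forall i, adm (D i)) -> adm (lim_hset F);
  adm_ind : forall H K (T : hset K), K \subset H ->
    adm (coset_hset H K) -> adm T -> adm (ind_hset H T) }.

Definition indexing_le (I J : indexing_system) :=
  forall H (S : hset H), adm I S -> adm J S.

Definition complete_indexing : indexing_system.
Proof. by exists (fun _ _ => True). Defined.

Definition indexing_cap (T : Type) (J : T -> indexing_system) : indexing_system.
Proof.
exists (fun H S => forall t, adm (J t) S).
- by move=> H S S' iso aS t; apply: adm_iso iso _.
- by move=> H K g sKH S aS t; apply: adm_res.
- by move=> H S triv t; apply: adm_triv.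
- by move=> H S S' aS aS' t; apply: adm_sum.
- by move=> H I E src tgt D F aD t; apply: adm_lim => i; apply: aD.
- by move=> H K S sKH aHK aS t; apply: adm_ind.
Defined.

Lemma indexing_cap_le T (J : T -> indexing_system) t :
  indexing_le (indexing_cap J) (J t).
Proof. by move=> H S aS; apply: aS. Qed.

Lemma complete_indexing_max J : indexing_le J complete_indexing.
Proof. by []. Qed.

Section IL.
Variable L : {group gT}.

Definition conj_to (L' : {group gT}) := L' \in orbit 'JG [set: gT] L.

(** The orbit of x is isomorphic to H/K through f. *)
Definition admL H (S : hset H) : Prop := forall x : S, exists K : {group gT},
  [/\ K \subset H,
      exists f : hmap (coset_hset H K) S,
        injective f /\ [set f C | C : coset_hset H K] = orbit (hact S) H x
    & forall L' : {group gT}, conj_to L' -> L' \subset H -> L' \subset K].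

Lemma conj_toJ (L' : {group gT}) g : conj_to L' -> conj_to (L' :^ g)%G.
Proof.
by case/orbitP=> a _ <-; apply/orbitP; exists (a * g); rewrite // actM.
Qed.

Lemma admLP H (S : hset H) : admL S <->
  forall L' : {group gT}, conj_to L' -> L' \subset H ->
    forall x : S, {in L', forall a, hact S x a = x}.
Proof.
split=> [aS L' cL sLH x a La | tS x].
  have [K [sKH [f [finj fim]] sLK]] := aS x.
  have: x \in [set f C | C : coset_hset H K] by rewrite fim orbit_refl.
  case/imsetP=> C _ ->; have Ha := subsetP sLH a La.
  rewrite -hfunP //; congr (f _); apply: val_inj; rewrite coset_hsetE //.
  have /rcosetsP[h Hh ->] := valP C; rewrite -rcosetM.
  have Kb : a ^ h^-1 \in K.
    apply: (subsetP (sLK (L' :^ h^-1)%G (conj_toJ _ cL) _)); last first.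
      by rewrite memJ_conjg.
    by rewrite -(conjGid (groupVr Hh)) conjSg.
  have -> : h * a = (a ^ h^-1) * h by rewrite conjgE invgK !mulgA mulgKV.
  by rewrite rcosetM rcoset_id.
pose K := [group of 'C_H[x | hact S]].
have Kact b : b \in K -> b \in H /\ hact S x b = x.
  by case/setIP=> Hb /setIP[_]; rewrite inE sub1set inE => /eqP.
have inK b : b \in H -> hact S x b = x -> b \in K.
  by move=> Hb xb; rewrite !inE Hb sub1set inE xb eqxx.
exists K; split; first exact: subsetIl.
- have repK (C : coset_hset H K) : exists2 h, h \in H & val C = K :* h.
    by have /rcosetsP := valP C.
  have rep_in (C : coset_hset H K) : repr (val C) \in H /\ val C = K :* repr (val C).
    have [h Hh ->] := repK C; have /rcosetP[k /Kact[Hk _] rE] := mem_repr_rcoset K h.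
    by rewrite rcoset_repr rE groupM.
  have actK h k : h \in H -> k \in K :* h -> hact S x k = hact S x h.
    by move=> Hh /rcosetP[b /Kact[Hb xb] ->]; rewrite hactM // xb.
  have fP (C : coset_hset H K) : {in H, forall a,
      hact S x (repr (val (hact (coset_hset H K) C a))) =
      hact S (hact S x (repr (val C))) a}.
    move=> a Ha; have [Hr Cr] := rep_in C.
    rewrite -hactM //; apply: actK; first by rewrite groupM.
    by rewrite coset_hsetE // {1}Cr -rcosetM mem_repr_rcoset.
  exists (HMap fP); split=> [C D /= eCD|].
    apply: val_inj; have [Hc ->] := rep_in C; have [Hd ->] := rep_in D.
    apply/rcoset_eqP; rewrite mem_rcoset; apply: inK; rewrite ?groupM ?groupV //.
    by rewrite hactM ?groupV // eCD -hactM ?groupV // mulgV hact1.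
  apply/setP=> y; apply/imsetP/orbitP=> [[C _ ->]|[h Hh <-]].
    by have [Hc _] := rep_in C; exists (repr (val C)).
  exists (mk_coset K Hh) => //=.
  by apply/esym/actK => //; rewrite mem_repr_rcoset.
- move=> L' cL sLH; apply/subsetP=> a La.
  by apply: inK; [apply: (subsetP sLH) | apply: (tS L')].
Qed.

Definition indexing_L : indexing_system.
Proof.
exists admL.
- move=> H S T [f [f' fK f'K]] /admLP aS; apply/admLP=> L' cL sLH y a La.
  have Ha := subsetP sLH a La.
  by rewrite -[y]f'K -hfunP // (aS L').
- move=> H K g sKH S /admLP aS; apply/admLP=> L' cL sLK x a La.
  rewrite mk_hsetE ?(subsetP sLK) //.
  apply: (aS (L' :^ g^-1)%G (conj_toJ _ cL)); last by rewrite memJ_conjg.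
  by rewrite sub_conjgV (subset_trans sLK).
- move=> H S tS; apply/admLP=> L' cL sLH x a La.
  by apply: tS; rewrite (subsetP sLH).
- move=> H S T /admLP aS /admLP aT; apply/admLP=> L' cL sLH x a La.
  rewrite mk_hsetE ?(subsetP sLH) //.
  by case: x => x; congr (_ _); [apply: (aS L') | apply: (aT L')].
- move=> H I E src tgt D F aD; apply/admLP=> L' cL sLH x a La.
  have Ha := subsetP sLH a La; apply: val_inj.
  rewrite sub_hsetE // mk_hsetE //; apply/ffunP=> i; rewrite ffunE.
  by have /admLP aDi := aD i; apply: (aDi L').
- move=> H K T sKH /admLP aHK /admLP aT; apply/admLP=> L' cL sLH x a La.
  have Ha := subsetP sLH a La; apply: val_inj; rewrite sub_hsetE // mk_hsetE //.
  have /existsP[s /existsP[h /andP[Hh /eqP->]]] := valP x.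
  have sub (g : gT) : g \in H -> L' :^ g \subset H.
    by move=> Hg; rewrite -(conjGid Hg) conjSg.
  have sLK : L' :^ h^-1 \subset K.
    apply/subsetP=> b Lb.
    have := aHK (L' :^ h^-1)%G (conj_toJ _ cL) (sub _ (groupVr Hh))
       (mk_coset K (group1 H)) b Lb.
    move/(congr1 val); rewrite coset_hsetE /= ?rcoset1.
      by move=> eK; rewrite -[X in _ \in pred_of_set X]eK rcoset_refl.
    exact: (subsetP (sub _ (groupVr Hh))).
  have Lc : a ^ h^-1 \in L' :^ h^-1 by rewrite memJ_conjg.
  have Kc := subsetP sLK _ Lc.
  have sc : hact T s (a ^ h^-1) = s.
    by apply: (aT (L' :^ h^-1)%G (conj_toJ _ cL)).
  rewrite -imset_comp -{2}sc -ind_classM // conjgE invgK mulgA mulgKV.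
  by apply: eq_imset => k /=; rewrite mulgA.
Defined.
End IL.
End Indexing.

Arguments conj_to {gT} L L'.
Arguments complete_indexing_max {gT} J.
Arguments indexing_cap_le {gT T} J t.

(** * Bispans of finite G-sets, for G = [set: gT] *)

Section Bispans.
Variable gT : finGroupType.
Implicit Types H K : {group gT}.

Definition gset := hset [set: gT]%G.

Definition stab (X : gset) (x : X) : {group gT} := [group of 'C[x | hact X]].

Lemma stabP (X : gset) (x : X) a : reflect (hact X x a = x) (a \in stab x).
Proof. by rewrite !inE sub1set inE; apply: eqP. Qed.

Lemma gmapE (X Y : gset) (f : hmap X Y) x a : f (hact X x a) = hact Y (f x) a.
Proof. by rewrite hfunP ?inE. Qed.

(** The diagram X <-bf- bY -bg-> bZ -bh-> W. *)
Record bispan (X W : gset) := Bispan {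
  bY : gset; bZ : gset;
  bf : hmap bY X; bg : hmap bY bZ; bh : hmap bZ W }.

Definition bispan_iso (X W : gset) (p q : bispan X W) :=
  exists (u : hmap (bY p) (bY q)) (v : hmap (bZ p) (bZ q)),
    [/\ bijective u, bijective v,
        forall y, bf q (u y) = bf p y,
        forall y, bg q (u y) = v (bg p y)
      & forall z, bh q (v z) = bh p z].

Lemma bispan_iso_refl (X W : gset) (p : bispan X W) : bispan_iso p p.
Proof. by exists (id_hmap _), (id_hmap _); split=> //; exists id. Qed.

Definition bispan_id (X : gset) : bispan X X :=
  Bispan (id_hmap X) (id_hmap X) (id_hmap X).
Definition res_bispan (X Y : gset) (f : hmap Y X) : bispan X Y :=
  Bispan f (id_hmap Y) (id_hmap Y).
Definition norm_bispan (X Y : gset) (f : hmap X Y) : bispan X Y :=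
  Bispan (id_hmap X) f (id_hmap Y).
Definition tr_bispan (X Y : gset) (f : hmap X Y) : bispan X Y :=
  Bispan (id_hmap X) (id_hmap X) f.

(** The composite of p = (X <-f- A -g-> B -h-> Y) and q = (Y <-k- C -m-> D -n-> Z)
   is X <- A' -> D' -> Z, where
   - D' is the dependent product along m of the pullback of B and C over Y: its
     elements are pairs (d, s) of d in D and a map s from the fibre of m at d
     to B such that h (s c) = k c;
   - A' is the set of triples (a, c, (d, s)) with m c = d and s c = g a.
   The map s is encoded as a function C -> option B, with value None outside the
   fibre of m at d. *)
Section Compose.
Variables (X Y Z : gset) (p : bispan X Y) (q : bispan Y Z).
Let B := bZ p.
Let C := bY q.
Let D := bZ q.

Let sact (s : {ffun C -> option B}) a : {ffun C -> option B} :=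
  [ffun c => omap (fun b => hact B b a) (s (hact C c a^-1))].

Lemma section_hset1 s : sact s 1 = s.
Proof.
by apply/ffunP=> c; rewrite ffunE invg1 hact1; case: (s c) => //= b; rewrite hact1.
Qed.

Lemma section_hsetM s : {in [set: gT]%G &, forall a b, sact s (a * b) = sact (sact s a) b}.
Proof.
move=> a b _ _; apply/ffunP=> c; rewrite !ffunE invMg hactM ?inE //.
by case: (s _) => //= x; rewrite hactM ?inE.
Qed.

Definition section_hset : gset := mk_hset section_hset1 section_hsetM.

Definition is_section (t : pair_hset D section_hset) :=
  [forall c, if bg q c == t.1 then
               if t.2 c is Some b then bh p b == bf q c else false
             else t.2 c == None].

Lemma is_section_stable (t : pair_hset D section_hset) : {in [set: gT]%G, forall a,
  is_section t -> is_section (hact (pair_hset D section_hset) t a)}.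
Proof.
case: t => d s a Ga /forallP sP; apply/forallP=> c.
rewrite mk_hsetE //= inE /= ffunE.
have := sP (hact C c a^-1); rewrite /= !gmapE.
have -> : (hact D (bg q c) a^-1 == d) = (bg q c == hact D d a).
  by rewrite -(inj_eq (act_inj (hact D) a)) -hactM ?inE // mulVg hact1.
case: ifP => _; last by move/eqP->.
case: (s _) => //= b /eqP eb.
by rewrite gmapE eb -hactM ?inE // mulVg hact1.
Qed.

Definition comp_bZ : gset := sub_hset is_section_stable.

Definition is_comp_bY (t : pair_hset (pair_hset (bY p) C) comp_bZ) :=
  (bg q t.1.2 == (val t.2).1) && ((val t.2).2 t.1.2 == Some (bg p t.1.1)).

Lemma comp_bY_stable t : {in [set: gT]%G, forall a, is_comp_bY t ->
  is_comp_bY (hact (pair_hset (pair_hset (bY p) C) comp_bZ) t a)}.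
Proof.
move=> a Ga; case: t => [[x c] ds] /andP[/eqP e1 /eqP e2].
cbn [fst snd] in e1, e2.
have E := sub_hsetE ds Ga.
rewrite /is_comp_bY !pair_hsetE //; cbn [fst snd].
rewrite E pair_hsetE // mk_hsetE //; cbn [fst snd].
by rewrite ffunE !gmapE e1 eqxx -hactM ?inE // mulgV hact1 e2 /= eqxx.
Qed.

Definition comp_bY : gset := sub_hset comp_bY_stable.

Lemma comp_bfP (t : comp_bY) : {in [set: gT]%G, forall a,
  bf p (val (hact comp_bY t a)).1.1 = hact X (bf p (val t).1.1) a}.
Proof. by move=> a Ga; rewrite sub_hsetE // !pair_hsetE // -gmapE. Qed.
Definition comp_bf : hmap comp_bY X := HMap comp_bfP.

Lemma comp_bgP (t : comp_bY) : {in [set: gT]%G, forall a,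
  (val (hact comp_bY t a)).2 = hact comp_bZ (val t).2 a}.
Proof. by move=> a Ga; rewrite sub_hsetE // pair_hsetE. Qed.
Definition comp_bg : hmap comp_bY comp_bZ := HMap comp_bgP.

Lemma comp_bhP (t : comp_bZ) : {in [set: gT]%G, forall a,
  bh q (val (hact comp_bZ t a)).1 = hact Z (bh q (val t).1) a}.
Proof. by move=> a Ga; rewrite sub_hsetE // pair_hsetE // -gmapE. Qed.
Definition comp_bh : hmap comp_bZ Z := HMap comp_bhP.

Definition bispan_comp : bispan X Z := Bispan comp_bf comp_bg comp_bh.
End Compose.

Definition admissible (J : indexing_system gT) (X W : gset) (p : bispan X W) :=
  forall y : bY p, adm J (coset_hset (stab (bg p y)) (stab y)).

Lemma admissible_stab J (X W : gset) (p : bispan X W) :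
  (forall y : bY p, stab (bg p y) \subset stab y) -> admissible J p.
Proof.
move=> sub y; apply: adm_triv => C a Ga; apply: val_inj; rewrite coset_hsetE //.
have /rcosetsP[h Hh ->] := valP C; rewrite -rcosetM.
by rewrite !rcoset_id ?(subsetP (sub y)) ?groupM.
Qed.

Lemma admissible_id J X : admissible J (bispan_id X).
Proof. exact: admissible_stab. Qed.
Lemma admissible_res J (X Y : gset) (f : hmap Y X) : admissible J (res_bispan f).
Proof. exact: admissible_stab. Qed.
Lemma admissible_tr J (X Y : gset) (f : hmap X Y) : admissible J (tr_bispan f).
Proof. exact: admissible_stab. Qed.
Lemma admissible_fold J (X : gset) : admissible J (norm_bispan (fold_hmap X)).
Proof.
apply: admissible_stab => y; apply/subsetP=> a sa; apply/stabP.
have := elimT (stabP (fold_fun y) a) sa.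
by rewrite /= inE; case: y sa => x _ /= ->.
Qed.

Arguments admissible_id : clear implicits.
Arguments admissible_res J {X Y} f.
Arguments admissible_tr J {X Y} f.
Arguments admissible_fold : clear implicits.

Lemma admissible_le I J (X W : gset) (p : bispan X W) :
  indexing_le I J -> admissible I p -> admissible J p.
Proof. by move=> sIJ aP y; apply: sIJ. Qed.

Lemma admissible_complete (X W : gset) (p : bispan X W) :
  admissible (complete_indexing gT) p.
Proof. by []. Qed.

(** * Incomplete Tambara functors

   A functor out of a category whose morphisms are isomorphism classes of
   bispans is given on bispans and is invariant under isomorphism.  The product
   of X and Y in that category is X + Y, with the restrictions along the two
   inclusions as projections.  The ring structure is no additional datum: its
   addition and multiplication are required to be those induced by the transfers
   and norms along fold maps. *)

Local Open Scope ring_scope.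

Record tambara (J : indexing_system gT) := Tambara {
  tval :> gset -> comPzRingType;
  tact : forall (X W : gset) (p : bispan X W), admissible J p -> tval X -> tval W;
  tact_iso : forall (X W : gset) (p q : bispan X W)
      (ap : admissible J p) (aq : admissible J q),
    bispan_iso p q -> tact ap =1 tact aq;
  tact_id : forall X, tact (admissible_id J X) =1 id;
  tact_comp : forall (X Y Z : gset) (p : bispan X Y) (q : bispan Y Z)
      (ap : admissible J p) (aq : admissible J q)
      (aqp : admissible J (bispan_comp p q)),
    tact aqp =1 tact aq \o tact ap;
  tact_empty : forall x y : tval (triv_hset _ void), x = y;
  tact_sum : forall X Y, bijective (fun w : tval (sum_hset X Y) =>
    (tact (admissible_res J (inl_hmap X Y)) w,
     tact (admissible_res J (inr_hmap X Y)) w));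
  tact_add : forall (X : gset) (w : tval (sum_hset X X)),
    tact (admissible_tr J (fold_hmap X)) w =
    tact (admissible_res J (inl_hmap X X)) w +
    tact (admissible_res J (inr_hmap X X)) w;
  tact_mul : forall (X : gset) (w : tval (sum_hset X X)),
    tact (admissible_fold J X) w =
    tact (admissible_res J (inl_hmap X X)) w *
    tact (admissible_res J (inr_hmap X X)) w }.

Definition tres J (T : tambara J) (X Y : gset) (f : hmap Y X) : T X -> T Y :=
  tact (admissible_res J f).
Definition ttr J (T : tambara J) (X Y : gset) (f : hmap X Y) : T X -> T Y :=
  tact (admissible_tr J f).

Record tambara_hom J (S T : tambara J) := TambaraHom {
  thom :> forall X : gset, S X -> T X;
  thomP : forall (X W : gset) (p : bispan X W) (ap : admissible J p) (x : S X),
    thom (tact ap x) = tact ap (thom x) }.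

Definition tambara_iso J (S T : tambara J) (h : tambara_hom S T) :=
  exists k : tambara_hom T S,
    (forall X, cancel (h X) (k X)) /\ (forall X, cancel (k X) (h X)).

Lemma tact_irr J (T : tambara J) (X W : gset) (p : bispan X W)
  (ap ap' : admissible J p) : tact (t := T) ap =1 tact ap'.
Proof. by apply: tact_iso; apply: bispan_iso_refl. Qed.

Section Forget.
Variables (I J : indexing_system gT) (sIJ : indexing_le I J) (T : tambara J).
Definition forget : tambara I.
Proof.
exists T (fun X W p ap => tact (admissible_le sIJ ap)).
- by move=> X W p q ap aq; apply: tact_iso.
- by move=> X x; rewrite -[RHS]tact_id; apply: tact_irr.
- by move=> X Y Z p q ap aq aqp x; apply: tact_comp.
- exact: tact_empty.
- move=> X Y; have [g fK gK] := tact_sum T X Y; exists g => w.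
    by rewrite -[RHS]fK; congr (g (_, _)); apply: tact_irr.
  by rewrite -[RHS]gK; congr (_, _); apply: tact_irr.
- move=> X w; rewrite -(tact_irr (admissible_tr J _)) tact_add.
  by congr (_ + _); apply: tact_irr.
- move=> X w; rewrite -(tact_irr (admissible_fold J _)) tact_mul.
  by congr (_ * _); apply: tact_irr.
Defined.
End Forget.

Section ProdRing.
Variables (I : finType) (R : I -> comPzRingType).
Definition prod_ring := {dffun forall i, R i}.
HB.instance Definition _ := Choice.on prod_ring.
Implicit Types x y z : prod_ring.
Definition prod_zero : prod_ring := [ffun i => 0].
Definition prod_opp x : prod_ring := [ffun i => - x i].
Definition prod_add x y : prod_ring := [ffun i => x i + y i].
Definition prod_one : prod_ring := [ffun i => 1].
Definition prod_mul x y : prod_ring := [ffun i => x i * y i].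

Lemma prod_addA : associative prod_add.
Proof. by move=> x y z; apply/ffunP=> i; rewrite !ffunE addrA. Qed.
Lemma prod_addC : commutative prod_add.
Proof. by move=> x y; apply/ffunP=> i; rewrite !ffunE addrC. Qed.
Lemma prod_add0 : left_id prod_zero prod_add.
Proof. by move=> x; apply/ffunP=> i; rewrite !ffunE add0r. Qed.
Lemma prod_addN : left_inverse prod_zero prod_opp prod_add.
Proof. by move=> x; apply/ffunP=> i; rewrite !ffunE addNr. Qed.
Lemma prod_mulA : associative prod_mul.
Proof. by move=> x y z; apply/ffunP=> i; rewrite !ffunE mulrA. Qed.
Lemma prod_mulC : commutative prod_mul.
Proof. by move=> x y; apply/ffunP=> i; rewrite !ffunE mulrC. Qed.
Lemma prod_mul1 : left_id prod_one prod_mul.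
Proof. by move=> x; apply/ffunP=> i; rewrite !ffunE mul1r. Qed.
Lemma prod_mulD : left_distributive prod_mul prod_add.
Proof. by move=> x y z; apply/ffunP=> i; rewrite !ffunE mulrDl. Qed.

HB.instance Definition _ :=
  GRing.isZmodule.Build prod_ring prod_addA prod_addC prod_add0 prod_addN.
HB.instance Definition _ := GRing.Zmodule_isComPzRing.Build prod_ring
  prod_mulA prod_mulC prod_mul1 prod_mulD.
End ProdRing.

Section Product.
Variables (J : indexing_system gT) (I : finType) (T : I -> tambara J).
Definition prod_act (X W : gset) (p : bispan X W) (ap : admissible J p)
    (x : prod_ring (fun i => T i X)) : prod_ring (fun i => T i W) :=
  [ffun i => tact ap (x i)].

Definition tambara_prod : tambara J.
Proof.
exists (fun X => prod_ring (fun i => T i X)) prod_act.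
- move=> X W p q ap aq pq x; apply/ffunP=> i; rewrite !ffunE.
  exact: tact_iso.
- by move=> X x; apply/ffunP=> i; rewrite ffunE tact_id.
- by move=> X Y Z p q ap aq aqp x; apply/ffunP=> i; rewrite !ffunE (tact_comp ap aq).
- by move=> x y; apply/ffunP=> i; apply: tact_empty.
- move=> X Y.
  have [g gP] := fin_all_exists (fun i =>
    let: Bijective g fK gK := tact_sum (T i) X Y in
    ex_intro (fun g => cancel _ g /\ cancel g _) g (conj fK gK)).
  exists (fun w : prod_ring (fun i => T i X) * prod_ring (fun i => T i Y) =>
    [ffun i => g i (w.1 i, w.2 i)] : prod_ring (fun i => T i (sum_hset X Y)))
    => [w|[w1 w2]].
    by apply/ffunP=> i; rewrite !ffunE; apply: (gP i).1.
  by congr (_, _); apply/ffunP=> i; rewrite !ffunE;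
     have := (gP i).2 (w1 i, w2 i) => -[].
- by move=> X w; apply/ffunP=> i; rewrite !ffunE tact_add.
- by move=> X w; apply/ffunP=> i; rewrite !ffunE tact_mul.
Defined.
End Product.
End Bispans.

Arguments admissible_id {gT} J X.
Arguments admissible_res {gT} J {X Y} f.
Arguments admissible_tr {gT} J {X Y} f.
Arguments admissible_fold {gT} J X.
Arguments admissible_complete {gT X W} p.

Section Burnside.
Variable gT : finGroupType.
Implicit Types H K L Q : {group gT}.
Local Notation gset := (gset gT).

(** The orbit G/H. *)
Definition orb H : gset := coset_hset [set: gT]%G H.

(** In terms of right cosets, the map G/K -> G/H given by K x |-> H g x. *)
Section OrbMap.
Variables (H K : {group gT}) (g : gT) (sKH : K \subset H :^ g).

Lemma orb_map_subproof (C : orb K) :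
  (H :* g * val C)%g \in rcosets H [set: gT].
Proof.
have /rcosetsP[x _ ->] := valP C; apply/rcosetsP; exists (g * x)%g; rewrite ?inE //.
rewrite mulgA rcosetM; congr (_ * _)%g; apply/eqP; rewrite eqEsubset.
apply/andP; split; last by rewrite mulG_subl.
apply/subsetP=> y /mulsgP[u k /rcosetP[h Hh ->] Kk ->].
have : k \in H :^ g by apply: (subsetP sKH).
rewrite mem_conjg => Hk; apply/rcosetP; exists (h * k ^ g^-1)%g.
  by rewrite groupM.
by rewrite conjgE invgK !mulgA mulgKV.
Qed.

Definition orb_map_fun (C : orb K) : orb H :=
  exist (fun A => A \in rcosets H [set: gT]) (H :* g * val C)%g
    (orb_map_subproof C).

Lemma orb_mapP C : {in [set: gT]%G, forall a,
  orb_map_fun (hact (orb K) C a) = hact (orb H) (orb_map_fun C) a}.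
Proof.
by move=> a Ga; apply: val_inj; rewrite coset_hsetE //= coset_hsetE //= mulgA.
Qed.
Definition orb_map : hmap (orb K) (orb H) := HMap orb_mapP.
End OrbMap.

Section OrbProj.
Variables (H K : {group gT}) (sKH : K \subset H).
Lemma sub_conj1 : K \subset H :^ 1. Proof. by rewrite conjsg1. Qed.
Definition orb_proj : hmap (orb K) (orb H) := orb_map sub_conj1.
End OrbProj.

Local Open Scope ring_scope.

(** A(-): a Tambara functor A whose ring A(G/H) is the Burnside ring of finite
   H-sets, that is, the Grothendieck ring of isomorphism classes under disjoint
   union and product, [bcl S] being the class of S; on classes of sets the
   restrictions (and conjugations), transfers and norms of A are restriction (and
   conjugation), induction and co-induction. *)
Record burnside := Burnside {
  btam :> tambara (complete_indexing gT);
  bcl : forall H, hset H -> btam (orb H);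
  bcl_iso : forall H (S T : hset H), hiso S T -> bcl S = bcl T;
  bcl_add : forall H (S T : hset H), bcl (sum_hset S T) = bcl S + bcl T;
  bcl_mul : forall H (S T : hset H), bcl (pair_hset S T) = bcl S * bcl T;
  bcl_one : forall H, bcl (triv_hset H unit) = 1;
  bcl_gen : forall H (x : btam (orb H)), exists S T : hset H, x = bcl S - bcl T;
  bcl_eq : forall H (S T : hset H), bcl S = bcl T ->
    exists U : hset H, hiso (sum_hset S U) (sum_hset T U);
  bcl_res : forall H K g (sKH : K \subset H :^ g) (S : hset H),
    tres (orb_map sKH) (bcl S) = bcl (res_hset sKH S);
  bcl_tr : forall H K (sKH : K \subset H) (S : hset K),
    ttr (orb_proj sKH) (bcl S) = bcl (ind_hset H S);
  bcl_norm : forall H K (sKH : K \subset H) (S : hset K),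
    tact (admissible_complete (norm_bispan (orb_proj sKH))) (bcl S) =
    bcl (coind_hset H S) }.

(** phi^Q, on A(G) = A(G/G). *)
Record mark (A : burnside) Q := Mark {
  mark_hom :> {rmorphism A (orb [set: gT]%G) -> int};
  markP : forall S : gset, mark_hom (bcl A S) = (#|'Fix_(hact S)(Q)|)%:Z }.

(** O^solv(Q); [Osolv_least] and [Osolv_normal_solvable] show that this intersection is the least, hence
   the unique minimal, normal subgroup with solvable quotient. *)
Definition Osolv Q : {group gT} :=
  (\bigcap_(N : {group gT} | (N <| Q) && solvable (Q / N)%g) N)%G.

Lemma Osolv_least Q (N : {group gT}) :
  N <| Q -> solvable (Q / N)%g -> Osolv Q \subset N.
Proof. by move=> nN sN; apply: bigcap_inf; rewrite nN. Qed.

Lemma solvable_quo_der Q (N : {group gT}) : N <| Q ->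
  solvable (Q / N)%g -> exists n, Q^`(n)%g \subset N.
Proof.
move=> nN /derivedP[n]; rewrite -quotient_der ?normal_norm // => dn; exists n.
by rewrite -quotient_sub1 ?(subset_trans (der_sub _ _) (normal_norm nN)) // dn.
Qed.

Lemma Osolv_normal_solvable Q : (Osolv Q <| Q) && solvable (Q / Osolv Q)%g.
Proof.
have nQQ : (Q <| Q) && solvable (Q / Q)%g.
  by rewrite normal_refl trivg_quotient solvable1.
have nO : Osolv Q <| Q.
  apply/andP; split; first exact: (bigcap_inf Q).
  by apply: norms_bigcap; apply/bigcapsP=> N /andP[/normal_norm].
rewrite nO; apply/derivedP.
have [f fP] : exists f : {group gT} -> nat, forall N : {group gT},
    (N <| Q) && solvable (Q / N)%g -> Q^`(f N)%g \subset N.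
  apply: (fin_all_exists (P := fun (N : {group gT}) n =>
    (N <| Q) && solvable (Q / N)%g -> Q^`(n)%g \subset N)) => N.
  case: (boolP ((N <| Q) && solvable (Q / N)%g)) => [/andP[nN sN]|_].
    by have [n dn] := solvable_quo_der nN sN; exists n.
  by exists 0%N.
exists (\max_N f N)%N; rewrite -quotient_der ?normal_norm //.
apply/quotientS1/bigcapsP=> N NP; apply: subset_trans (fP N NP).
rewrite -(subnK (leq_bigmax N)); elim: (_ - _)%N => //= k.
exact/subset_trans/der_subS.
Qed.

Definition perfect Q := Osolv Q == Q.

Definition perfect_reps : finType :=
  {L : {group gT} | L \in orbit_transversal 'JG [set: gT] [set L | perfect L]}.

Definition rep (L : perfect_reps) : {group gT} := val L.

Definition is_idempotent_of (A : burnside) (phi : forall Q, mark A Q) L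
    (e : A (orb [set: gT]%G)) :=
  forall Q, phi Q e = (conj_to L (Osolv Q))%:R.

(** f is a localization of R at s: it inverts s, every element of R' is a fraction,
   and f identifies only elements that are equal after multiplication by a power
   of s. *)
Definition is_localization (R R' : comPzRingType) (f : R -> R') (s : R) :=
  [/\ exists t, t * f s = 1,
      forall y, exists a n, y * f s ^+ n = f a
    & forall a b, f a = f b -> exists n, s ^+ n * a = s ^+ n * b].

(** The localization map A -> B = A[e^-1], as a morphism of J-Tambara functors. *)
Definition is_tambara_localization (A : burnside) J (B : tambara J)
    (l : tambara_hom (forget (complete_indexing_max J) A) B)
    (e : A (orb [set: gT]%G)) :=
  forall H, is_localization (l (orb H)) (tres (orb_proj (subsetT H)) e).

Definition indexing_I : indexing_system gT :=
  indexing_cap (fun L : perfect_reps => indexing_L (rep L)).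

Lemma indexing_I_le (L : perfect_reps) : indexing_le indexing_I (indexing_L (rep L)).
Proof. exact: indexing_cap_le. Qed.
End Burnside.

Arguments indexing_I_le {gT} L.

(* Main.v *)
Require Import Defs.
From mathcomp Require Import all_boot all_order all_algebra.
From mathcomp Require Import all_fingroup all_solvable.

Set Implicit Arguments.
Unset Strict Implicit.
Unset Printing Implicit Defensive.

Import GroupScope GRing.Theory.

(** Write G for [set: gT].  The components of the comparison map are natural
   because the localization maps are, so it is a morphism of I-Tambara functors,
   and a morphism all of whose values are bijective is an isomorphism
   ([bij_tambara_iso]).  Since the values of a Tambara functor turn disjoint
   unions into products and every finite G-set is a disjoint union of orbits,
   bijectivity need only be checked on the orbits G/H ([thom_bij_orb]).

   There the map is A(H) -> prod_L A(H)[R^G_H(e_L)^-1].  For a family of pairwise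
   orthogonal idempotents with sum 1 in a commutative ring, the localizations at
   its members are the factors of the corresponding product decomposition
   ([localizations_bij]).  So what is left is that the R^G_H(e_L) form such a
   family; as R^G_H is a ring homomorphism ([tresD], [res1], [resM]), this
   reduces to the e_L in A(G).  By the Burnside theorem on marks an element of
   A(G) is determined by its marks ([marks_inj]), and phi^Q(e_L) is 1 for exactly
   one L: O^solv(Q) is a term of the derived series of Q, hence perfect
   ([perfect_Osolv]), and is conjugate to exactly one representative
   ([perfect_rep_of]).

   In a Tambara functor addition and multiplication are the transfer and the norm
   along fold maps.  Morphisms commute with these, hence are additive and
   multiplicative ([thomD], [thomM]); restrictions are additive by a comparison
   of two composites of bispans ([span_comp]). *)

Lemma inj_surj_bij (T : choiceType) (U : eqType) (f : T -> U) :
  injective f -> (forall y, exists x, f x = y) -> bijective f.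
Proof.
move=> finj fsurj.
have fsurjb y : exists x, f x == y by have [x <-] := fsurj y; exists x.
have fK y : f (xchoose (fsurjb y)) = y by apply/eqP/(xchooseP (fsurjb y)).
by exists (fun y => xchoose (fsurjb y)) => // x; apply: finj.
Qed.

(** * Bispans without norms *)

Section Tambara.
Variable gT : finGroupType.
Local Notation gset := (gset gT).

(** The bispans that involve no norm: a restriction followed by a transfer. *)
Definition span (X Y W : gset) (f : hmap Y X) (h : hmap Y W) : bispan X W :=
  Bispan f (id_hmap Y) h.

Lemma admissible_span J (X Y W : gset) (f : hmap Y X) (h : hmap Y W) :
  admissible J (span f h).
Proof. exact: admissible_stab. Qed.

Arguments admissible_span J {X Y W} f h.

(** Spans compose by pullback.  The pullback is given by its universal property on
   points, so that in each application P can be chosen as a familiar G-set. *)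
Section SpanComp.
Variables (X B Y C Z P : gset).
Variables (f : hmap B X) (h : hmap B Y) (k : hmap C Y) (n : hmap C Z).
Variables (pb : hmap P B) (pc : hmap P C) (pf : hmap P X) (pn : hmap P Z).
Hypothesis pfE : forall t, pf t = f (pb t).
Hypothesis pnE : forall t, pn t = n (pc t).
Hypothesis sqE : forall t, h (pb t) = k (pc t).
Hypothesis pinj : forall t t', pb t = pb t' -> pc t = pc t' -> t = t'.
Hypothesis psurj : forall b c, h b = k c -> exists t, pb t = b /\ pc t = c.

Let pq := bispan_comp (span f h) (span k n).

(** The fibre of the identity of C at pc t is the single point pc t, so a section
   over it is one point of B. *)
Let pt_fun (t : P) : pair_hset C (section_hset (span f h) (span k n)) :=
  (pc t, [ffun c => if c == pc t then Some (pb t) else None]).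

Let pt_section t : is_section (p := span f h) (q := span k n) (pt_fun t).
Proof.
by apply/forallP=> c /=; rewrite ffunE; case: eqP => [->|//]; rewrite sqE.
Qed.

Let v_fun (t : P) : bZ pq := Sub (pt_fun t) (pt_section t).

Let vP t : {in [set: gT]%G, forall a, v_fun (hact P t a) = hact (bZ pq) (v_fun t) a}.
Proof.
move=> a Ga; apply: val_inj; rewrite [RHS]sub_hsetE // pair_hsetE //= /pt_fun.
rewrite !gmapE Ga; congr (_, _); apply/ffunP=> c; rewrite !ffunE.
rewrite -(inj_eq (act_inj (hact C) a) (hact C c a^-1)) -hactM ?inE // mulVg hact1.
by case: eqP.
Qed.

Let u_sub t : is_comp_bY (p := span f h) (q := span k n) ((pb t, pc t), v_fun t).
Proof. by rewrite /is_comp_bY /= ffunE !eqxx. Qed.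

Let u_fun (t : P) : bY pq := Sub ((pb t, pc t), v_fun t) (u_sub t).

Let uP t : {in [set: gT]%G, forall a, u_fun (hact P t a) = hact (bY pq) (u_fun t) a}.
Proof.
move=> a Ga; apply: val_inj; rewrite [RHS]sub_hsetE // pair_hsetE // pair_hsetE //=.
by congr (_, _, _); [rewrite gmapE | rewrite gmapE | exact: vP].
Qed.

Let v_inj : injective v_fun.
Proof.
move=> t t' /(congr1 val) [ec /ffunP/(_ (pc t))]; rewrite !ffunE eqxx ec eqxx.
by case=> eb; apply: pinj.
Qed.

Let v_surj y : exists t, v_fun t = y.
Proof.
case: y => -[d s] sP; have /forallP sd := sP.
have := sd d; rewrite /= eqxx; case sE: (s d) => [b|//] /eqP hb.
have [t [tb tc]] := psurj hb; exists t; apply: val_inj; congr (_, _) => //=.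
apply/ffunP=> c; rewrite ffunE tc tb; case: eqP => [->|/eqP nc] //.
by have := sd c; rewrite /= (negPf nc) => /eqP.
Qed.

Lemma span_comp : bispan_iso (span pf pn) pq.
Proof.
exists (HMap uP), (HMap vP); split=> //; last exact: inj_surj_bij v_surj.
apply: inj_surj_bij => [t t' /(congr1 (fun y => (val y).2))|]; first exact: v_inj.
case=> -[[b c] ds] /= yP; have [t tE] := v_surj ds; exists t.
apply: val_inj => /=; case/andP: (yP); rewrite -tE /= ffunE => /eqP->.
by rewrite eqxx => /eqP[->].
Qed.

Variables (J : indexing_system gT) (T : tambara J).
Variables (ap : admissible J (span f h)) (aq : admissible J (span k n)).
Variable apq : admissible J (span pf pn).

Lemma tact_span_comp : tact (t := T) apq =1 tact aq \o tact ap.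
Proof.
have [u [v [[u' uK u'K] [v' vK v'K] _ ug _]]] := span_comp.
(* The middle map of the composite is injective, which makes it admissible for
   every J. *)
have a_pq : admissible J pq.
  apply: admissible_stab => y; apply/subsetP=> a /stabP ya; apply/stabP.
  rewrite -[y]u'K -gmapE; congr (u _); apply: (can_inj vK).
  by move: ya; rewrite -{1}[y]u'K -[y in RHS]u'K ug -gmapE.
by move=> x; rewrite -(tact_comp ap aq a_pq); apply: tact_iso; apply: span_comp.
Qed.
End SpanComp.

(** * Orbit decomposition *)

(** A G-set is the disjoint union of the orbit of x, which is a copy of G/G_x, and
   of its complement. *)
Section Decomp.
Variables (X : gset) (x : X).

Definition off_orbit (y : X) := y \notin orbit (hact X) [set: gT] x.
Lemma off_orbit_stable y :
  {in [set: gT]%G, forall a, off_orbit y -> off_orbit (hact X y a)}.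
Proof.
move=> a _; apply: contra => /orbitP[b _ e].
apply/orbitP; exists (b * a^-1)%g; rewrite ?inE // actMin ?inE // e.
by rewrite -actMin ?inE // mulgV act1.
Qed.
Definition rest : gset := sub_hset off_orbit_stable.

Lemma act_repr a : hact X x (repr (stab x :* a)) = hact X x a.
Proof.
have /rcosetP[b /stabP xb ->] := mem_repr_rcoset (stab x) a.
by rewrite actMin ?inE // xb.
Qed.

Definition split_fun (z : sum_hset (orb (stab x)) rest) : X :=
  match z with inl C => hact X x (repr (val C)) | inr y => val y end.

Lemma split_mapP z : {in [set: gT]%G, forall a,
  split_fun (hact (sum_hset (orb (stab x)) rest) z a) = hact X (split_fun z) a}.
Proof.
move=> a Ga; rewrite mk_hsetE //; case: z => [C|y] /=; last exact: sub_hsetE.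
rewrite coset_hsetE //; have /rcosetsP[b _ /= eC] := valP C.
by rewrite /= !eC -rcosetM !act_repr actMin ?inE.
Qed.
Definition split_map := HMap split_mapP.

Lemma split_map_bij : bijective split_map.
Proof.
apply: inj_surj_bij => [|y].
  have orb_in (C : orb (stab x)) : split_fun (inl C) \in orbit (hact X) [set: gT] x.
    by apply/orbitP; exists (repr (val C)); rewrite ?inE.
  move=> [C|y] [D|z] e; last 1 first.
  - by congr inr; apply: val_inj.
  - congr inl; apply: val_inj; move: e => /=.
    have /rcosetsP[b _ ->] := valP C; have /rcosetsP[c _ ->] := valP D.
    rewrite !act_repr => e; apply/rcoset_eqP; rewrite mem_rcoset; apply/stabP.
    by rewrite actMin ?inE // e -actMin ?inE // mulgV act1.
  - by have := valP z; rewrite /off_orbit -[val z]e orb_in.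
  - by have := valP y; rewrite /off_orbit -[val y]/(split_map (inr y)) e orb_in.
case: (boolP (off_orbit y)) => [yP|/negPn/orbitP[a _ <-]].
  by exists (inr (Sub y yP)).
by exists (inl (mk_coset (stab x) (in_setT a))); rewrite /= act_repr.
Qed.

Lemma card_rest : #|rest| < #|X|.
Proof.
rewrite card_sub; apply: proper_card; apply/properP; split; first exact/subsetP.
by exists x; rewrite // unfold_in /off_orbit negbK orbit_refl.
Qed.
End Decomp.

(** * Restrictions *)

Section Res.
Local Open Scope ring_scope.
Variables (J : indexing_system gT) (T : tambara J).

Lemma comp_hmapP (X Y Z : gset) (f : hmap Y X) (g : hmap Z Y) z :
  {in [set: gT]%G, forall a, f (g (hact Z z a)) = hact X (f (g z)) a}.
Proof. by move=> a _; rewrite !gmapE. Qed.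
Definition comp_hmap (X Y Z : gset) (f : hmap Y X) (g : hmap Z Y) : hmap Z X :=
  HMap (comp_hmapP f g).

Lemma tres_comp (X Y Z : gset) (f : hmap Y X) (g : hmap Z Y) (fg : hmap Z X) :
  (forall z, fg z = f (g z)) -> tres (J := J) (T := T) fg =1 tres g \o tres f.
Proof.
move=> fgE; apply: (tact_span_comp (pb := g) (pc := id_hmap Z)) => //.
by move=> b c /= e; exists c.
Qed.

Lemma tres_id (X : gset) (f : hmap X X) : f =1 id -> tres (J := J) (T := T) f =1 id.
Proof.
move=> fE x; rewrite -[RHS](tact_id (t := T)); apply: tact_iso.
by exists (id_hmap X), (id_hmap X); split=> //; exists id.
Qed.

Lemma tres_bij (X Y : gset) (f : hmap Y X) :
  bijective f -> bijective (tres (J := J) (T := T) f).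
Proof.
case=> g fK gK.
have gP x : {in [set: gT]%G, forall a, g (hact X x a) = hact Y (g x) a}.
  by move=> a _; apply: (can_inj fK); rewrite gmapE !gK.
exists (tres (T := T) (HMap gP)) => x.
  have e : forall x, id_hmap X x = f (HMap gP x) by move=> t /=; rewrite gK.
  by rewrite -[LHS](tres_comp e) tres_id.
have e : forall x, id_hmap Y x = HMap gP (f x) by move=> t /=; rewrite fK.
by rewrite -[LHS](tres_comp e) tres_id.
Qed.

Lemma tsum_surj (X Y : gset) (x : T X) (y : T Y) : exists w : T (sum_hset X Y),
  tres (inl_hmap X Y) w = x /\ tres (inr_hmap X Y) w = y.
Proof.
by have [g gK gK'] := tact_sum T X Y; exists (g (x, y)); have [] := gK' (x, y).
Qed.

Section SumMap.
Variables (X Y : gset) (f : hmap Y X).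
Definition sum_map_fun (z : sum_hset Y Y) : sum_hset X X :=
  match z with inl y => inl (f y) | inr y => inr (f y) end.
Lemma sum_mapP z : {in [set: gT]%G, forall a,
  sum_map_fun (hact (sum_hset Y Y) z a) = hact (sum_hset X X) (sum_map_fun z) a}.
Proof. by move=> a Ga; rewrite !mk_hsetE //; case: z => z /=; rewrite gmapE. Qed.
Definition sum_map := HMap sum_mapP.
End SumMap.

(** Both restriction along f after the transfer along the fold map of X, and the
   transfer along the fold map of Y after restriction along f + f, are the span
   X + X <- Y + Y -> Y. *)
Lemma tresD (X Y : gset) (f : hmap Y X) :
  {morph tres (J := J) (T := T) f : x y / x + y}.
Proof.
move=> x y; have [w [<- <-]] := tsum_surj x y; rewrite -tact_add.
have a_f := admissible_span J (sum_map f) (fold_hmap Y).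
have -> : tres f (ttr (fold_hmap X) w) = tact (t := T) a_f w.
  symmetry; apply: (tact_span_comp (pb := sum_map f) (pc := fold_hmap Y)) => //.
  - by case.
  - by case=> z; case=> z' //= [_] ->.
  - by move=> [b|b] c /= ->; [exists (inl c) | exists (inr c)].
have -> : tact (t := T) a_f w = ttr (fold_hmap Y) (tres (sum_map f) w).
  apply: (tact_span_comp (pb := id_hmap _) (pc := id_hmap _)) => //.
  by move=> b c /= ->; exists c.
rewrite [LHS]tact_add; congr (_ + _).
  rewrite -[RHS](tres_comp (fg := comp_hmap (inl_hmap X X) f)) //.
  by rewrite (tres_comp (f := sum_map f) (g := inl_hmap Y Y)).
rewrite -[RHS](tres_comp (fg := comp_hmap (inr_hmap X X) f)) //.
by rewrite (tres_comp (f := sum_map f) (g := inr_hmap Y Y)).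
Qed.
End Res.

(** * Morphisms of Tambara functors *)

Section Hom.
Local Open Scope ring_scope.
Variables (J : indexing_system gT) (S T : tambara J) (h : tambara_hom S T).

Lemma thom_tres (X Y : gset) (f : hmap Y X) x : h Y (tres f x) = tres f (h X x).
Proof. exact: thomP. Qed.

(** Sums and products are images of one element of S (X + X) under the transfer and
   the norm along the fold map, and these commute with h. *)
Lemma thomD X : {morph h X : x y / x + y}.
Proof.
move=> x y; have [w [<- <-]] := tsum_surj x y.
by rewrite -tact_add thomP tact_add !thom_tres.
Qed.

Lemma thomM X : {morph h X : x y / x * y}.
Proof.
move=> x y; have [w [<- <-]] := tsum_surj x y.
by rewrite -tact_mul thomP tact_mul !thom_tres.
Qed.

Lemma thom_bij_iso (X Y : gset) (f : hmap Y X) :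
  bijective f -> bijective (h Y) -> bijective (h X).
Proof.
move=> fbij [k hK kK].
have [s fsK sfK] := tres_bij S fbij; have [t ftK tfK] := tres_bij T fbij.
exists (fun y => s (k (tres f y))) => [x|y].
  by rewrite -thom_tres hK fsK.
by apply: (can_inj ftK); rewrite -thom_tres sfK kK.
Qed.

Lemma thom_bij_sum (X Y : gset) :
  bijective (h X) -> bijective (h Y) -> bijective (h (sum_hset X Y)).
Proof.
move=> [k hK kK] [k' hK' kK'].
have [s rsK srK] := tact_sum S X Y; have [t rtK trK] := tact_sum T X Y.
exists (fun y => s (k (tres (inl_hmap X Y) y), k' (tres (inr_hmap X Y) y))) => [x|y].
  by rewrite -!thom_tres hK hK' rsK.
apply: (can_inj rtK); set w := s _.
have [e1 e2] : tres (inl_hmap X Y) w = k (tres (inl_hmap X Y) y) /\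
               tres (inr_hmap X Y) w = k' (tres (inr_hmap X Y) y).
  by have [e1 e2] := srK (k (tres (inl_hmap X Y) y), k' (tres (inr_hmap X Y) y)).
by congr (_, _); rewrite -[LHS]thom_tres (e1, e2) (kK, kK').
Qed.

Lemma thom_bij_empty (X : gset) : #|X| = 0%N -> bijective (h X).
Proof.
move/card0_eq => X0.
have xP (x : triv_hset [set: gT]%G void) : False by case: x.
have fP (x : triv_hset [set: gT]%G void) : {in [set: gT]%G, forall a,
    of_void X (hact (triv_hset [set: gT]%G void) x a) = hact X (of_void X x) a}.
  by case: x.
apply: (@thom_bij_iso X _ (HMap fP)).
  apply: inj_surj_bij => [z|y]; first by case: (xP z).
  by have := X0 y; rewrite inE.
by exists (fun=> 0) => x; apply: tact_empty.
Qed.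

Lemma thom_bij_orb : (forall H, bijective (h (orb H))) -> forall X, bijective (h X).
Proof.
move=> hbij X; have [n] := ubnP #|X|; elim: n X => // n IH X leXn.
have [x _|X0] := pickP X; last exact/thom_bij_empty/eq_card0.
apply: (thom_bij_iso (split_map_bij x)); apply: thom_bij_sum => //.
by apply: IH; apply: leq_trans (card_rest x) _.
Qed.

(** Naturality of the inverse is automatic.  Its values are picked by the choice
   operators of the rings, as the inverses that [bijective] asserts to exist are
   not given as a family in X. *)
Lemma bij_tambara_iso : (forall X, bijective (h X)) -> tambara_iso h.
Proof.
move=> hbij.
have hsurj X y : exists x, h X x == y.
  by have [k _ kK] := hbij X; exists (k y); rewrite kK.
pose k X y := xchoose (hsurj X y).
have kK X : cancel (k X) (h X) by move=> y; apply/eqP/(xchooseP (hsurj X y)).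
have hK X : cancel (h X) (k X) by move=> x; apply: (bij_inj (hbij X)); rewrite kK.
have kP X W (p : bispan X W) (ap : admissible J p) y :
    k W (tact (t := T) ap y) = tact (t := S) ap (k X y).
  by apply: (bij_inj (hbij W)); rewrite thomP !kK.
by exists (TambaraHom kP).
Qed.
End Hom.
End Tambara.

(** * Marks determine elements of the Burnside ring *)

Section Marks.
Variables (gT : finGroupType) (A : burnside gT) (phi : forall Q, mark A Q).
Local Notation gset := (gset gT).
Local Open Scope ring_scope.

Lemma bcl_split (X : gset) (x : X) : bcl A X = bcl A (orb (stab x)) + bcl A (rest x).
Proof.
by rewrite -bcl_add; apply/esym/bcl_iso; exists (split_map x); apply: split_map_bij.
Qed.

(** An empty X is isomorphic to X + X by the fold map, so its class is twice itself. *)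
Lemma bcl_empty (X : gset) : #|X| = 0%N -> bcl A X = 0.
Proof.
move/card0_eq=> X0; apply: (@addrI _ (bcl A X)); rewrite addr0 -bcl_add.
apply: bcl_iso; exists (fold_hmap X); apply: inj_surj_bij => [[x|x]|x].
- by have := X0 x; rewrite inE.
- by have := X0 x; rewrite inE.
- by exists (inl x).
Qed.

(** A subgroup Q of maximal order among those with a nonzero mark on S is the
   stabilizer of each of its fixed points, in S as well as in T.  So both S and T
   contain an orbit G/Q; taking it away from both preserves the equality of marks,
   and S gets smaller. *)
Lemma marks_bcl_inj (S T : gset) :
  (forall Q, phi Q (bcl A S) = phi Q (bcl A T)) -> bcl A S = bcl A T.
Proof.
have [n] := ubnP #|S|; elim: n S T => // n IH S T leSn eST.
have cardE (X : gset) : phi 1%G (bcl A X) = #|X|%:Z.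
  rewrite markP; congr (_%:Z); rewrite -cardsT; apply: eq_card => x.
  by rewrite !inE; apply/subsetP=> a /set1P->; rewrite inE act1.
have [x _|S0] := pickP S; last first.
  have T0 : T =i pred0.
    by apply/card0_eq/eqP; rewrite -eqz_nat -cardE -eST cardE eq_card0.
  by rewrite !bcl_empty // eq_card0.
pose P (Q : {group gT}) := phi Q (bcl A S) != 0.
have P1 : P 1%G.
  by rewrite /P cardE eqz_nat -lt0n; apply/card_gt0P; exists x.
have [Q PQ maxQ] := arg_maxnP (fun Q : {group gT} => #|Q|) P1.
have stabQ (X : gset) : (forall Q, phi Q (bcl A S) = phi Q (bcl A X)) ->
    exists y : X, stab y = Q.
  move=> eSX; move: PQ; rewrite /P eSX markP eqz_nat -lt0n => /card_gt0P[y].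
  move=> /afixP yQ; exists y; apply/eqP; rewrite eq_sym -val_eqE eqEcard.
  apply/andP; split; first by apply/subsetP=> a Qa; apply/stabP/yQ.
  apply: maxQ; rewrite /P eSX markP eqz_nat -lt0n; apply/card_gt0P; exists y.
  by apply/afixP=> a /stabP.
have [y yQ] := stabQ S (fun=> erefl); have [z zQ] := stabQ T eST.
rewrite (bcl_split y) (bcl_split z) yQ zQ; congr (_ + _); apply: IH.
  by apply: leq_trans (card_rest y) _.
move=> K; apply: (@addrI _ (phi K (bcl A (orb Q)))).
by rewrite -!rmorphD -{1}yQ -zQ -!bcl_split.
Qed.

Lemma marks_inj (x y : A (orb [set: gT]%G)) : (forall Q, phi Q x = phi Q y) -> x = y.
Proof.
have [S [S' ->]] := bcl_gen x; have [T [T' ->]] := bcl_gen y => e.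
apply/eqP; rewrite subr_eq addrAC eq_sym subr_eq -!bcl_add eq_sym; apply/eqP.
apply: marks_bcl_inj => Q; have := e Q; rewrite !bcl_add !rmorphB !rmorphD.
by move/eqP; rewrite subr_eq addrAC eq_sym subr_eq eq_sym => /eqP.
Qed.
End Marks.

(** * The solvable residual *)

Section SolvableResidual.
Variable gT : finGroupType.
Implicit Types (Q N : {group gT}).

Lemma Osolv_sub_der Q n : Osolv Q \subset Q^`(n).
Proof.
apply: Osolv_least; first exact: der_normal.
by apply/derivedP; exists n; rewrite -quotient_der ?der_norm // trivg_quotient.
Qed.

(** The derived series of Q enters [Osolv Q], as the quotient is solvable, and never
   drops below it, as each Q / Q^`(n) is solvable. *)
Lemma Osolv_der Q : exists n, Osolv Q = Q^`(n)%G.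
Proof.
have /andP[nO sO] := Osolv_normal_solvable Q.
have [n sn] := solvable_quo_der nO sO; exists n.
by apply/val_inj/eqP; rewrite eqEsubset sn Osolv_sub_der.
Qed.

Lemma perfectE Q : perfect Q = (Q \subset Q^`(1)).
Proof.
apply/eqP/idP=> [{1}<-|sQ]; first exact: Osolv_sub_der.
have [n On] := Osolv_der Q; rewrite On; apply/val_inj => /=.
have Q1 : Q^`(1) = Q by apply/eqP; rewrite eqEsubset sQ der_sub.
by elim: n {On} => // n IH; rewrite dergSn IH.
Qed.

(** If [Osolv Q] is Q^`(n), its derived group is Q^`(n.+1), which again contains
   [Osolv Q]. *)
Lemma perfect_Osolv Q : perfect (Osolv Q).
Proof.
have [n On] := Osolv_der Q.
by rewrite perfectE {2}On -[_^`(1)]/(Q^`(n.+1)) Osolv_sub_der.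
Qed.

Lemma perfectJ Q x : perfect (Q :^ x)%G = perfect Q.
Proof. by rewrite !perfectE /= derJ conjSg. Qed.

Lemma perfect_rep_of Q : exists L0 : perfect_reps gT,
  forall L : perfect_reps gT, conj_to (rep L) (Osolv Q) = (L == L0).
Proof.
have actsP : [acts [set: gT], on [set L : {group gT} | perfect L] | 'JG].
  by apply/actsP=> a _ L; rewrite !inE perfectJ.
have [_ _ trX /(_ (Osolv Q))[|a _ aX]] := orbit_transversalP actsP.
  by rewrite inE perfect_Osolv.
pose X := orbit_transversal 'JG [set: gT] [set L | perfect L].
exists (exist (fun L => L \in X) _ aX) => L.
rewrite -val_eqE /= -trX //; last exact: valP.
by rewrite /conj_to -(orbit_actr 'JG (rep L) (Osolv Q) (in_setT a)).
Qed.
End SolvableResidual.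

(** * Restrictions between Burnside rings are ring homomorphisms *)

Section Restriction.
Variables (gT : finGroupType) (A : burnside gT).
Variables (H K : {group gT}) (g : gT) (sKH : K \subset H :^ g).
Local Open Scope ring_scope.
Local Notation res := (tres (T := A) (orb_map sKH)).

Lemma resB : {morph res : x y / x - y}.
Proof. by move=> x y; apply: (@addIr _ (res y)); rewrite -tresD !subrK. Qed.

Lemma res1 : res 1 = 1.
Proof.
rewrite -!bcl_one bcl_res; apply: bcl_iso.
have fP (x : res_hset sKH (triv_hset H unit)) : {in K, forall a,
    tt = hact (triv_hset K unit) tt a} by move=> a Ka; rewrite mk_hsetE.
by exists (@HMap _ _ _ (triv_hset K unit) (fun=> tt) fP); exists (fun=> tt); case.
Qed.

(** On classes of H-sets this is that restriction commutes with products of sets;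
   the general case follows by additivity. *)
Lemma resM : {morph res : x y / x * y}.
Proof.
have resb (S T : hset H) : res (bcl A S * bcl A T) = res (bcl A S) * res (bcl A T).
  rewrite -bcl_mul !bcl_res -bcl_mul; apply: bcl_iso.
  pose P := res_hset sKH (pair_hset S T).
  pose Q := pair_hset (res_hset sKH S) (res_hset sKH T).
  have fP (x : P) : {in K, forall a, hact P x a = hact Q x a :> Q}.
    move=> a Ka; rewrite pair_hsetE // !mk_hsetE //.
    by rewrite -mem_conjg (subsetP sKH).
  by exists (@HMap _ _ P Q id fP); exists id.
move=> x y; have [S [S' ->]] := bcl_gen x; have [T [T' ->]] := bcl_gen y.
by rewrite !(mulrBl, mulrBr, resB, resb).
Qed.

Lemma res_sum (I : finType) (F : I -> A (orb H)) : res (\sum_i F i) = \sum_i res (F i).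
Proof.
apply: (big_morph res (tresD _)).
by apply: (@addrI _ (res 0)); rewrite -tresD !addr0.
Qed.
End Restriction.

(** * Localization at orthogonal idempotents *)

Section Idempotents.
Local Open Scope ring_scope.

(** Inverting the idempotent s i makes it equal to 1 and the s j with j != i, which
   it annihilates, equal to 0.  So every fraction is the image of some a i in R, and
   the sum of the s i * a i has the prescribed image in every localization.  If a
   and b agree in each localization, then s i * a = s i * b for all i, and summing
   over i gives a = b. *)
Lemma localizations_bij (I : finType) (R : comPzRingType) (R' : I -> comPzRingType)
    (s : I -> R) (f : forall i, R -> R' i) :
  (forall i j, s i * s j = if i == j then s i else 0) -> \sum_i s i = 1 ->
  (forall i, {morph f i : x y / x + y}) -> (forall i, {morph f i : x y / x * y}) ->
  (forall i, is_localization (f i) (s i)) ->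
  forall g : R -> {dffun forall i, R' i}, (forall x i, g x i = f i x) -> bijective g.
Proof.
move=> sM s1 fD fM fL g gE.
have fs i : f i (s i) = 1.
  have [[t ts] _ _] := fL i; rewrite -ts -{2}[s i](_ : s i * s i = _).
    by rewrite fM mulrA ts mul1r.
  by rewrite sM eqxx.
have f0 i : f i 0 = 0 by apply: (@addrI _ (f i 0)); rewrite -fD !addr0.
have sX i n : s i ^+ n * s i = s i.
  by elim: n => [|n IH]; rewrite ?mul1r // exprSr -mulrA sM eqxx.
have ginj : injective g.
  move=> a b ab; rewrite -[a]mul1r -[b]mul1r -s1 !mulr_suml.
  apply: eq_bigr => i _; have [_ _ /(_ a b)[|n en]] := fL i.
    by rewrite -!gE ab.
  by rewrite -(sX i n) ![_ * s i]mulrC -!mulrA en.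
have gsurj y : exists x, g x = y.
  have lift i : exists a, f i a = y i.
    have [_ /(_ (y i))[a [n e]] _] := fL i.
    by exists a; rewrite -e fs expr1n mulr1.
  have [a aP] := fin_all_exists lift.
  exists (\sum_i s i * a i); apply/ffunP=> i; rewrite gE.
  rewrite (big_morph (f i) (fD i) (f0 i)) (bigD1 i) //= fM fs mul1r aP.
  rewrite big1 ?addr0 // => j ji; rewrite fM -[f i (s j)]mulr1 -(fs i) -fM sM.
  by rewrite (negPf ji) f0 mul0r.
exact: inj_surj_bij.
Qed.

End Idempotents.

(** * Decomposition of the Burnside Tambara functor *)

Section PrimitiveIdempotents.
Variables (gT : finGroupType) (A : burnside gT) (phi : forall Q, mark A Q).
Local Open Scope ring_scope.
Variables (e : perfect_reps gT -> A (orb [set: gT]%G)).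
Hypothesis he : forall L : perfect_reps gT, is_idempotent_of phi (rep L) (e L).

Lemma idem_orth L M : e L * e M = if L == M then e L else 0.
Proof.
apply: (marks_inj (phi := phi)) => Q; have [L0 L0P] := perfect_rep_of Q.
rewrite rmorphM !he !L0P; have [<-|nLM] := eqVneq L M.
  by rewrite he L0P; case: eqP.
rewrite rmorph0; have [LL0|_] := eqVneq L L0; last by rewrite mul0r.
by rewrite -LL0 eq_sym (negPf nLM) mulr0.
Qed.

Lemma idem_sum : \sum_L e L = 1.
Proof.
apply: (marks_inj (phi := phi)) => Q; have [L0 L0P] := perfect_rep_of Q.
rewrite rmorph_sum rmorph1 (bigD1 L0) //= he L0P eqxx big1 ?addr0 // => L nL.
by rewrite he L0P (negPf nL).
Qed.
End PrimitiveIdempotents.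

Theorem corollaryE (gT : finGroupType) (A : burnside gT)
    (phi : forall Q : {group gT}, mark A Q)
    (e : perfect_reps gT -> A (orb [set: gT]%G))
    (he : forall L : perfect_reps gT, is_idempotent_of phi (rep L) (e L))
    (B : forall L : perfect_reps gT, tambara (indexing_L (rep L)))
    (l : forall L : perfect_reps gT,
       tambara_hom (forget (complete_indexing_max (indexing_L (rep L))) A) (B L))
    (hl : forall L : perfect_reps gT, is_tambara_localization (l L) (e L)) :
  exists h : tambara_hom (forget (complete_indexing_max (indexing_I gT)) A)
               (tambara_prod (fun L : perfect_reps gT =>
                  forget (indexing_I_le L) (B L))),
    (forall (X : gset gT) (x : A X) (L : perfect_reps gT), h X x L = l L X x) /\
    tambara_iso h.
Proof.
pose S := forget (complete_indexing_max (indexing_I gT)) A.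
pose P := tambara_prod (fun L : perfect_reps gT => forget (indexing_I_le L) (B L)).
pose h X (x : S X) : P X := [ffun L => l L X x].
have hP X W (p : bispan X W) (ap : admissible (indexing_I gT) p) (x : S X) :
    h W (tact ap x) = tact ap (h X x).
  apply/ffunP=> L; rewrite !ffunE /=.
  rewrite -(thomP (l L) (admissible_le (indexing_I_le L) ap)) /=.
  by congr (l L W _); apply: (tact_irr (T := A)).
pose H := TambaraHom hP.
have hE X (x : A X) L : H X x L = l L X x by rewrite ffunE.
exists H; split; first exact: hE.
have Hbij : forall X, bijective (H X).
  apply: thom_bij_orb => K.
  apply: (localizations_bij (s := fun L => tres (orb_proj (subsetT K)) (e L))
    (f := fun L => l L (orb K))) => //.
  - move=> L M; rewrite -resM (idem_orth he); case: eqP => // _.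
    by rewrite -(subrr (e L)) resB subrr.
  - by rewrite -res_sum (idem_sum he) res1.
  - by move=> L; apply: (thomD (l L)).
  - by move=> L; apply: (thomM (l L)).
  - by move=> L; apply: hl.
  - exact: hE.
exact: bij_tambara_iso.
Qed.
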